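(* Let $a$ be a positive integer. Then $B_a$, viewed as a map on the integers $\ge 2$, has only finitely many cycles, and for every integer $n\ge2$ the sequence of iterates $n, B_a(n), B_a^2(n),\dots$ eventually enters a cycle.
   Context: For an integer $n\ge 2$ with prime factorization $n=p_1^{r_1}\cdots p_k^{r_k}$, let $B(n)=\sum_{i=1}^k r_ip_i$. For a positive integer $a$, define $B_a(n)=n+a$ if $n$ is prime and $B_a(n)=B(n)$ otherwise; $B_a$ maps integers $\ge2$ to integers $\ge2$, and $B_a^k$ denotes its $k$-fold iterate. A point $m$ is periodic if $B_a^l(m)=m$ for some $l\ge 1$, and a cycle is the orbit of a periodic point. *)

(* Defs.v *)
From mathcomp Require Import all_boot.
From mathcomp Require Import classical_sets.

Set Implicit Arguments.
Unset Strict Implicit.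
Unset Printing Implicit Defensive.

Local Open Scope classical_set_scope.
Local Open Scope nat_scope.

Definition B (n : nat) : nat := \sum_(p <- primes n) logn p n * p.

Definition Ba (a n : nat) : nat := if prime n then n + a else B n.

(* [Ba a] is a self-map of the integers >= 2; the junk values at 0 and 1 are
   excluded by the hypothesis [1 < m] in [periodic]. *)
Lemma Ba_gt1 (a n : nat) : 1 < n -> 1 < Ba a n.
Proof.
move=> n_gt1; rewrite /Ba; case: ifP => _; first exact: ltn_addr.
have pn := pdiv_prime n_gt1.
have pnP : pdiv n \in primes n by rewrite mem_primes pn pdiv_dvd (ltnW n_gt1).
rewrite /B (big_rem _ pnP) /=; apply: ltn_addr.
by apply: (leq_trans (prime_gt1 pn)); apply: leq_pmull; rewrite logn_gt0.
Qed.

Definition periodic (a m : nat) : Prop :=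
  1 < m /\ exists l : nat, 1 <= l /\ iter l (Ba a) m = m.

Definition orbit_of (a m : nat) : set nat := [set iter k (Ba a) m | k in [set: nat]].

Definition is_cycle (a : nat) (C : set nat) : Prop :=
  exists m : nat, periodic a m /\ C = orbit_of a m.

(* Main.v *)
(** For composite [n] one has [2 * B n <= n + 4], while a prime [n] only moves
    up by [a].  Since [a = -1] modulo [a + 1], one of [n, n + a, ..., n + a * a]
    is divisible by [a + 1], so for [n > a + 1] a composite number is reached
    within [a] steps, and the next step goes below [n] as soon as
    [n > a * a + 4].  Hence every orbit returns infinitely often to the finite
    set of integers at most [a * a + a + 4], and every cycle meets that set. *)
Require Import Defs.
From mathcomp Require Import all_boot.
From mathcomp Require Import classical_sets cardinality.
From mathcomp Require Import zify.

Local Open Scope classical_set_scope.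
Local Open Scope nat_scope.

(** A range of summation independent of [n] lets [B m], [B n] and [B (m * n)] be compared term by
    term; the added terms vanish because [logn p n] is 0 off the prime divisors. *)
Lemma B_sum_nat (N n : nat) : 0 < n < N -> B n = \sum_(0 <= p < N) logn p n * p.
Proof.
move=> /andP[n_gt0 ltnN]; rewrite /B.
have eqp : perm_eq (primes n) [seq p <- index_iota 0 N | p \in primes n].
  apply: uniq_perm; [exact: primes_uniq | exact/filter_uniq/iota_uniq|] => p.
  rewrite mem_filter mem_index_iota /=; case: (boolP (p \in primes n)) => //=.
  rewrite mem_primes => /and3P[_ _ pn].
  by rewrite (leq_ltn_trans (dvdn_leq n_gt0 pn)).
rewrite (perm_big _ eqp) big_filter big_mkcond; apply: eq_bigr => p _.
by case: ifP => //; rewrite -logn_gt0; case: (logn p n).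
Qed.

Lemma BM (m n : nat) : 0 < m -> 0 < n -> B (m * n) = B m + B n.
Proof.
move=> m0 n0; rewrite !(B_sum_nat (m * n).+1) ?ltnS ?leqnn ?muln_gt0 ?m0 ?n0 //=.
- by rewrite -big_split; apply: eq_bigr => p _; rewrite lognM // mulnDl.
- exact: leq_pmull.
- exact: leq_pmulr.
Qed.

Lemma B_prime (p : nat) : prime p -> B p = p.
Proof.
by move=> pp; rewrite /B primes_prime // big_seq1 logn_prime // eqxx mul1n.
Qed.

Lemma composite_factor (n : nat) : 1 < n -> ~~ prime n ->
  exists p m : nat, [/\ prime p, 1 < m & n = p * m].
Proof.
move=> n1 np; exists (pdiv n), (n %/ pdiv n).
have En : n = pdiv n * (n %/ pdiv n) by rewrite mulnC divnK ?pdiv_dvd.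
split=> //; first exact: pdiv_prime.
have pp := pdiv_prime n1; move: En; case: (n %/ pdiv n) => [|[|q]] //; first lia.
by rewrite muln1 => E; move: np; rewrite E pp.
Qed.

(** Strong induction, splitting off one prime: [p + m <= p * m] once both factors are at least 2. *)
Lemma B_le (n : nat) : 0 < n -> B n <= n.
Proof.
elim/ltn_ind: n => n IH n0; case: (boolP (prime n)) => [pn|np].
  by rewrite B_prime.
have [-> | n1] := eqVneq n 1; first by rewrite /B big_nil.
have [||p [m [pp m1 En]]] := composite_factor n => //; first lia.
have p1 := prime_gt1 pp; have ltmn : m < n by nia.
have := IH m ltmn (ltnW m1).
have -> : B n = p + B m by rewrite En BM ?(ltnW p1) ?(ltnW m1) // B_prime.
nia.
Qed.

Lemma B_composite_le (n : nat) : 1 < n -> ~~ prime n -> 2 * B n <= n + 4.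
Proof.
move=> n1 np; have [p [m [pp m1 ->]]] := composite_factor n n1 np.
have p1 := prime_gt1 pp; have Bm := B_le m (ltnW m1).
rewrite BM ?(ltnW p1) ?(ltnW m1) // B_prime //.
have : 2 * (p + m) <= p * m + 4.
  (* With [p] and [m] written as 2 plus a remainder, this is [(p - 2) * (m - 2) >= 0]. *)
  by rewrite -(subnKC p1) -(subnKC m1); nia.
lia.
Qed.

Lemma iter_Ba_gt1 (a n k : nat) : 1 < n -> 1 < iter k (Ba a) n.
Proof. by move=> n1; elim: k => //= k; apply: Ba_gt1. Qed.

Lemma composite_progression (a n : nat) : 0 < a -> a.+1 < n ->
  exists2 j, j <= a & ~~ prime (n + j * a).
Proof.
(* If [r] is the remainder of [n], then [n + r * a] is congruent to [n - r], hence to 0, modulo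
   [a + 1]. *)
move=> a0 an; exists (n %% a.+1); first by rewrite -ltnS ltn_mod.
have d : a.+1 %| n + n %% a.+1 * a.
  rewrite {1}(divn_eq n a.+1) -addnA -mulnS dvdn_add ?dvdn_mull //.
apply/negP => /primeP[_ /(_ _ d)] /orP[] /eqP; lia.
Qed.

Lemma Ba_descent (a n : nat) : 0 < a -> a * a + a + 4 < n ->
  exists k, iter k (Ba a) n < n.
Proof.
move=> a0 ltn.
have [|j ja npj] := composite_progression a n a0; first lia.
(* Minimality of [k] makes all earlier terms prime, so [Ba a] just adds [a] up to step [k]. *)
have [k npk kmin] := ex_minnP (ex_intro (fun j => ~~ prime (n + j * a)) j npj).
have it i : i <= k -> iter i (Ba a) n = n + i * a.
  elim: i => [|i IH] ik; first by rewrite /= mul0n addn0.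
  rewrite iterS IH ?(ltnW ik) // /Ba ifT; first by rewrite mulSn; lia.
  by apply: contraTT ik => /kmin; rewrite -leqNgt.
exists k.+1; rewrite iterS it // /Ba (negbTE npk).
have ka : k <= a by apply: leq_trans (kmin _ npj) ja.
(* Here [2 * B (n + k * a) <= n + a * a + 4 < 2 * n]. *)
have := B_composite_le (n + k * a) ltac:(lia) npk; nia.
Qed.

Lemma Ba_reaches_small (a n : nat) : 0 < a ->
  exists k, iter k (Ba a) n <= a * a + a + 4.
Proof.
move=> a0; elim/ltn_ind: n => n IH.
have [small|big] := leqP n (a * a + a + 4); first by exists 0.
have [k /IH[l lP]] := Ba_descent a n a0 big.
by exists (l + k); rewrite iterD.
Qed.

(** Pigeonhole: [M + 2] distinct times whose iterates take only the [M + 1] values up to [M]. *)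
Lemma recurrent_collision (f : nat -> nat) (M n : nat) :
  (forall N, exists2 t, N <= t & iter t f n <= M) ->
  exists i j, i < j /\ iter i f n = iter j f n.
Proof.
move=> rec.
have [s [us ss sM]] : exists s : seq nat,
    [/\ uniq s, size s = M.+2 & forall t, t \in s -> iter t f n <= M].
  elim: M.+2 => [|L [s [us ss sM]]]; first by exists [::].
  (* A time beyond the maximum of [s] is automatically new. *)
  have [t lst tM] := rec (\max_(x <- s) x).+1.
  exists (t :: s); split=> /=; last first.
  - by move=> u; rewrite inE => /predU1P[-> | /sM].
  - by rewrite ss.
  rewrite us andbT; apply/negP => ts.
  by move: lst; rewrite ltnNge (leq_bigmax_seq t).
have [inj|] := boolP (uniq [seq iter t f n | t <- s]).
  have /(uniq_leq_size inj) : {subset [seq iter t f n | t <- s] <= iota 0 M.+1}.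
    by move=> _ /mapP[t /sM tM ->]; rewrite mem_iota.
  by rewrite size_map size_iota ss ltnn.
move=> /(uniqPn 0)[i [j [ij]]]; rewrite size_map => js.
rewrite !(nth_map 0) ?(ltn_trans ij) // => E.
have : nth 0 s i != nth 0 s j.
  by rewrite nth_uniq ?(ltn_trans ij) // neq_ltn ij.
rewrite neq_ltn => /orP[] lt; first by exists (nth 0 s i), (nth 0 s j).
by exists (nth 0 s j), (nth 0 s i).
Qed.

Lemma orbit_of_iter (a m k : nat) : periodic a m ->
  orbit_of a (iter k (Ba a) m) = orbit_of a m.
Proof.
move=> [_ [l [l1 lP]]].
have itm i : iter (i * l) (Ba a) m = m.
  by elim: i => // i IH; rewrite mulSn iterD IH.
apply/seteqP; split=> _ [i _ <-]; first by exists (i + k); rewrite ?iterD.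
(* From [iter k (Ba a) m], another [k * l - k] steps complete [k] full periods and return to [m];
   [k <= k * l] since [l >= 1]. *)
exists (i + (k * l - k)) => //; rewrite -iterD -addnA subnK ?leq_pmulr //.
by rewrite iterD itm.
Qed.

Theorem theorem3p4 (a : nat) (ha : 0 < a) :
  finite_set [set C : set nat | is_cycle a C] /\
  (forall n : nat, 2 <= n ->
     exists C : set nat, is_cycle a C /\
       exists N : nat, forall k : nat, N <= k -> C (iter k (Ba a) n)).
Proof.
split.
  (* Each cycle is the orbit of any of its points, in particular of one below the bound. *)
  apply: (@sub_finite_set _ _ (orbit_of a @` `I_(a * a + a + 4).+1)).
    move=> _ [m [pm ->]]; have [k kP] := Ba_reaches_small a m ha.
    by exists (iter k (Ba a) m); rewrite ?orbit_of_iter.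
  exact/finite_image/finite_II.
move=> n n1.
have [N|i [j [ij E]]] := recurrent_collision (Ba a) (a * a + a + 4) n.
  have [k kP] := Ba_reaches_small a (iter N (Ba a) n) ha.
  by exists (k + N); rewrite ?leq_addl // iterD.
exists (orbit_of a (iter i (Ba a) n)); split.
  exists (iter i (Ba a) n); split=> //; split; first exact: iter_Ba_gt1.
  by exists (j - i); rewrite subn_gt0 -iterD subnK ?(ltnW ij).
by exists i => k ik; exists (k - i); rewrite -?iterD ?subnK.
Qed.
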